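(* Let $K$ be a field, let $n\geq 1$, let $A_1,\ldots,A_n$ be non-empty finite subsets of $K$, let $d_i=|A_i|$, and let $X^*=A_1\times\cdots\times A_n\subset K^n$. Let $G\in K[t_1,\ldots,t_n]$ be a polynomial of total degree $d\geq 1$ such that $\deg_{t_i}(G)\leq d_i-1$ for $i=1,\ldots,n$. If $d_i\leq d_{i+1}$ for all $i$ and $d=\sum_{i=1}^k(d_i-1)+\ell$ for some integers $k,\ell$ such that $1\leq\ell\leq d_{k+1}-1$ and $0\leq k\leq n-1$, then $$ |Z_{X^*}(G)|\leq d_{k+2}\cdots d_n\,(d_1\cdots d_{k+1}-d_{k+1}+\ell), $$ where we set $d_{k+2}\cdots d_n=1$ if $k=n-1$.
   Context: $Z_{X^*}(G)$ denotes the set of zeros of $G$ in $X^*$, i.e. $\{P\in X^* : G(P)=0\}$, and $\deg_{t_i}(G)$ denotes the degree of $G$ in the variable $t_i$. *)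

(* Defs.v *)
From mathcomp Require Import all_boot all_order all_algebra.
From mathcomp Require Import finmap mpoly.

Set Implicit Arguments.
Unset Strict Implicit.
Unset Printing Implicit Defensive.

Import GRing.Theory.
Local Open Scope fset_scope.
Local Open Scope ring_scope.

(* Points of K^n are finite functions {ffun 'I_n -> K}; indices run from 0 to
   n - 1.  The product is the image of the dependent functions choosing an
   element of A i for every i; see in_cartesian. *)
Definition cartesian (K : choiceType) (n : nat) (A : 'I_n -> {fset K}) :
    {fset {ffun 'I_n -> K}} :=
  [fset [ffun i => val ((f : {dffun forall i : 'I_n, A i}) i)]
     | f in {: {dffun forall i : 'I_n, A i}}].

Lemma in_cartesian (K : choiceType) (n : nat) (A : 'I_n -> {fset K})
    (P : {ffun 'I_n -> K}) :
  P \in cartesian A = [forall i, P i \in A i].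
Proof.
apply/imfsetP/forallP => [[f _ ->] i|PA]; first by rewrite ffunE fsvalP.
exists [ffun i => [` PA i]] => //.
by apply/ffunP => i; rewrite !ffunE.
Qed.

Definition zeros (K : fieldType) (n : nat) (X : {fset {ffun 'I_n -> K}})
    (G : {mpoly K[n]}) : {fset {ffun 'I_n -> K}} :=
  [fset P in X | G.@[P] == 0].

(* With the convention that the zero polynomial has degree 0. *)
Definition degvar (K : fieldType) (n : nat) (i : 'I_n) (G : {mpoly K[n]}) :
    nat :=
  (\max_(m <- msupp G) m i)%N.

(* Main.v *)
(* Expanding G along one variable t_j and keeping its top coefficient, of degree
   e in t_j, costs a factor d_j - e in the number of nonzeros: over a point
   where the top coefficient does not vanish, G is a univariate polynomial of
   degree e.  Iterating over the variables (a lexicographic leading monomial)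
   gives a monomial m of G such that G has at least prod_i (d_i - m_i) nonzeros
   in X^*.  As sum_i m_i <= d and m_i < d_i, this product is at least its value
   at the greedy exponents, which exhaust the smallest d_i first, namely
   (d_{k+1} - l) d_{k+2} ... d_n. *)
Require Import Defs.
From mathcomp Require Import all_boot all_order all_algebra.
From mathcomp Require Import finmap mpoly zify.

Set Implicit Arguments.
Unset Strict Implicit.
Unset Printing Implicit Defensive.

Import GRing.Theory.

(** * Minimizing a product of factors [d i - m i] when the sum of the [m i] is bounded *)

Section Greedy.
Variables (I : eqType) (d : I -> nat).

(* The value of the product of the d i - m i when a total exponent T is spent
   greedily, each m i being filled up to d i - 1 before the next one. *)
Fixpoint greedy (s : seq I) (T : nat) : nat :=
  if s is i :: s' then
    if T < d i then (d i - T) * \prod_(j <- s') d j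
    else greedy s' (T - (d i).-1)
  else 1.

(** View [u] as one more factor: emptying it hands its [u - 1] units to the list. If they fit in the
    current factor, use $b+u-1\le ub$ for $b\ge 1$; if they overflow, the excess is below [u], so a
    next factor, being at least [u], absorbs it. *)
Lemma greedy_shift (u : nat) (s : seq I) (T : nat) :
  0 < u -> (forall i, i \in s -> u <= d i) ->
  greedy s T <= u * greedy s (T + u.-1).
Proof.
move=> u_gt0; elim: s T => [|i s IHs] T /= le_ud; first by rewrite muln1.
have le_u_i : u <= d i by apply: le_ud; rewrite mem_head.
have {}le_ud j : j \in s -> u <= d j.
  by move=> js; apply: le_ud; rewrite in_cons js orbT.
have [lt1|le1] := ltnP (T + u.-1) (d i).
  rewrite ifT; last by lia.
  by rewrite mulnA leq_mul2r; apply/orP; right; nia.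
case: ifP => [lt2|ge2]; last first.
  rewrite (_ : T + u.-1 - (d i).-1 = (T - (d i).-1) + u.-1); last by lia.
  exact: IHs.
case: s le_ud {IHs} => [|j s] /= le_ud; first by rewrite big_nil; lia.
have le_u_j : u <= d j by apply: le_ud; rewrite mem_head.
rewrite ifT; last by lia.
by rewrite big_cons !mulnA leq_mul2r; apply/orP; right; nia.
Qed.

(** Exchange argument: filling the first, smallest factor takes [d i - 1 - m i] units from the tail,
    and [greedy_shift] with [u = d i - m i] shows that the product does not grow. *)
Lemma leq_greedy_prod (m : I -> nat) (s : seq I) (T : nat) :
  pairwise (fun i j => d i <= d j) s -> (forall i, i \in s -> m i < d i) ->
  \sum_(i <- s) m i <= T -> greedy s T <= \prod_(i <- s) (d i - m i).
Proof.
elim: s T => [|i s IHs] T /=; first by rewrite !big_nil.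
case/andP => /allP le_d_i sorted_s lt_md; rewrite !big_cons => le_mT.
have lt_md_i : m i < d i by apply: lt_md; rewrite mem_head.
have le_mi : m i <= T by apply: leq_trans le_mT; apply: leq_addr.
have {}lt_md j : j \in s -> m j < d j.
  by move=> js; apply: lt_md; rewrite in_cons js orbT.
have le_tail : greedy s (T - m i) <= \prod_(j <- s) (d j - m j).
  by apply: IHs => //; lia.
apply: (@leq_trans ((d i - m i) * greedy s (T - m i))); last first.
  by rewrite leq_mul2l le_tail orbT.
case: ifP => [ltT|geT].
  (* Here the head can take the whole budget: moving [T - m i] units onto it from the next factor,
     which is at least as large, does not increase the product. *)
  case: s le_d_i {IHs sorted_s lt_md le_mT le_tail} => [|j s] /= le_d_i.
    by rewrite big_nil; lia.
  have le_ij : d i <= d j by apply: le_d_i; rewrite mem_head.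
  rewrite ifT; last by lia.
  by rewrite big_cons !mulnA leq_mul2r; apply/orP; right; nia.
rewrite (_ : T - m i = T - (d i).-1 + (d i - m i).-1); last by lia.
apply: greedy_shift; first by lia.
by move=> j /le_d_i; lia.
Qed.

(** As [0 < l], the budget reaching each factor of [s1] suffices to fill it, which leaves a factor
    1; exactly [l] units arrive at [i]. *)
Lemma greedy_cat (s1 : seq I) (i : I) (s2 : seq I) (l : nat) :
  0 < l < d i ->
  greedy (s1 ++ i :: s2) (\sum_(j <- s1) (d j - 1) + l) =
  (d i - l) * \prod_(j <- s2) d j.
Proof.
case/andP=> l_gt0 lt_l; elim: s1 => [|j s1 IHs] /=.
  by rewrite big_nil add0n lt_l.
rewrite big_cons ifF; last by lia.
by rewrite -IHs; congr greedy; lia.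
Qed.

End Greedy.

(** * The greedy bound over ordinals, cut at [k] *)

Lemma leq_mono_ord (n : nat) (d : 'I_n -> nat) :
  (forall i j : 'I_n, j = i.+1 :> nat -> d i <= d j) ->
  forall i j : 'I_n, i <= j -> d i <= d j.
Proof.
move=> d_step i [j ltj]; elim: j ltj => [|j IHj] ltj /= le_ij.
  by rewrite (_ : Ordinal ltj = i) //; apply/val_inj => /=; lia.
have [eq_ij|ne_ij] := eqVneq (i : nat) j.+1.
  by rewrite (_ : Ordinal ltj = i) //; apply/val_inj.
apply: leq_trans (IHj (ltnW ltj) _) _; first by rewrite /=; lia.
exact: d_step.
Qed.

Lemma pairwise_ord_enum (n : nat) :
  pairwise (fun i j : 'I_n => i < j) (index_enum 'I_n).
Proof.
rewrite -(pairwise_map val ltn) /index_enum -enumT val_enum_ord.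
by rewrite -sorted_pairwise ?iota_ltn_sorted //; apply: ltn_trans.
Qed.

Lemma enum_ord_split (n : nat) (k : 'I_n) : exists s1 s2 : seq 'I_n,
  [/\ index_enum 'I_n = s1 ++ k :: s2, {in s1, forall i : 'I_n, i < k}
    & {in s2, forall i : 'I_n, k < i}].
Proof.
have := pairwise_ord_enum n.
case/splitPr: (mem_index_enum k) => s1 s2.
rewrite pairwise_cat /= allrel_consr.
case/and3P=> /andP[/allP lt1 _] _ /andP[/allP lt2 _].
by exists s1, s2; split.
Qed.

Lemma prod_subn_geq (n : nat) (d m : 'I_n -> nat) (k : 'I_n) (l : nat) :
  (forall i j : 'I_n, i <= j -> d i <= d j) -> (forall i, m i < d i) ->
  0 < l < d k -> \sum_i m i <= \sum_(i < n | i < k) (d i - 1) + l ->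
  (d k - l) * \prod_(i < n | k < i) d i <= \prod_i (d i - m i).
Proof.
move=> mono lt_md lt_l.
have sorted_d : pairwise (fun i j => d i <= d j) (index_enum 'I_n).
  by apply: sub_pairwise (pairwise_ord_enum n) => i j /ltnW; apply: mono.
have [s1 [s2 [def_s lt1 lt2]]] := enum_ord_split k.
rewrite def_s in sorted_d *; rewrite !big_cat !big_cons /= ltnn.
have -> : \sum_(i <- s1 | i < k) (d i - 1) = \sum_(i <- s1) (d i - 1).
  rewrite big_seq_cond [RHS]big_seq; apply: eq_bigl => i.
  by case: (boolP (i \in s1)) => //= /lt1.
have -> : \sum_(i <- s2 | i < k) (d i - 1) = 0.
  by rewrite big_seq_cond big1 // => i /andP[/lt2]; lia.
have -> : \prod_(i <- s1 | k < i) d i = 1.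
  by rewrite big_seq_cond big1 // => i /andP[/lt1]; lia.
have -> : \prod_(i <- s2 | k < i) d i = \prod_(i <- s2) d i.
  rewrite big_seq_cond [RHS]big_seq; apply: eq_bigl => i.
  by case: (boolP (i \in s2)) => //= /lt2.
rewrite addn0 mul1n => le_m.
have le_all : \sum_(i <- s1 ++ k :: s2) m i <= \sum_(i <- s1) (d i - 1) + l.
  by rewrite big_cat big_cons.
have := leq_greedy_prod sorted_d (fun i _ => lt_md i) le_all.
by rewrite greedy_cat // big_cat big_cons.
Qed.

Local Open Scope ring_scope.

(** * Expansion of a polynomial along one variable *)

Section VariableCoefficients.
Variables (K : fieldType) (n : nat).
Implicit Types (G : {mpoly K[n]}) (P : {ffun 'I_n -> K}).

Definition varsupp (j : 'I_n) (e : nat) G : seq 'X_{1..n} :=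
  [seq (m - U_(j) *+ e)%MM | m : 'X_{1..n} <- msupp G & m j == e].

(** The coefficient of $t_j^e$, free of $t_j$ but kept in the same ring, so that an induction on the
    variables never changes [n]. *)
Definition varcoef (j : 'I_n) (e : nat) G : {mpoly K[n]} :=
  \sum_(m <- varsupp j e G) G@_(m + U_(j) *+ e)%MM *: 'X_[m].

Definition update P (j : 'I_n) (t : K) : {ffun 'I_n -> K} :=
  [ffun i => if i == j then t else P i].

Lemma subm_varK (j : 'I_n) (m : 'X_{1..n}) :
  (m - U_(j) *+ m j + U_(j) *+ m j)%MM = m.
Proof.
apply: submK; apply/mnm_lepP => i; rewrite mulmnE mnm1E.
by case: eqP => [<-|_]; rewrite ?mul1n ?mul0n.
Qed.

(** Nothing cancels: removing $t_j^e$ is injective on the monomials of exponent [e] in $t_j$. *)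
Lemma msupp_varcoef (j : 'I_n) (e : nat) G :
  msupp (varcoef j e G) =i varsupp j e G.
Proof.
apply/perm_mem/msupp_sumX.
  rewrite map_inj_in_uniq ?filter_uniq ?msupp_uniq // => m1 m2.
  rewrite !mem_filter => /andP[/eqP e1 _] /andP[/eqP e2 _] eq12.
  by rewrite -(subm_varK j m1) -(subm_varK j m2) e1 e2 eq12.
move=> m /mapP[m1]; rewrite mem_filter => /andP[/eqP <- m1G] ->.
by rewrite subm_varK -mcoeff_msupp.
Qed.

Lemma meval_update P (j : 'I_n) (t : K) G (D : nat) :
  (degvar j G <= D)%N ->
  G.@[update P j t] = \sum_(e < D.+1) (varcoef j e G).@[P] * t ^+ e.
Proof.
move=> le_D.
have le_mD m : m \in msupp G -> (m j < D.+1)%N.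
  by move=> mG; rewrite ltnS (leq_trans _ le_D) // (leq_bigmax_seq m).
rewrite mevalE big_seq_cond.
(* Monomials are grouped by their exponent in $t_j$; [inord] is faithful because that exponent is at
   most [D]. *)
rewrite (partition_big (fun m : 'X_{1..n} => inord (m j) : 'I_D.+1) xpredT) //=.
apply: eq_bigr => e _.
rewrite /varcoef /varsupp rmorph_sum [in RHS]big_map big_filter mulr_suml.
rewrite [in RHS]big_seq_cond.
apply: eq_big => [m|m /andP[/andP[mG _] /eqP eq_e]].
  rewrite andbT; case: (boolP (m \in msupp G)) => //= mG.
  by rewrite -(inj_eq val_inj) /= inordK // le_mD.
have {}eq_e : (e : nat) = m j by rewrite -eq_e inordK // le_mD.
rewrite eq_e subm_varK /= mevalZ mevalX -mulrA; congr (_ * _).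
rewrite (bigD1 j) //= [in RHS](bigD1 j) //= !ffunE eqxx.
rewrite mnmBE mulmnE mnm1E eqxx mul1n subnn expr0 mul1r mulrC; congr (_ * _).
apply: eq_bigr => i ne_ij; rewrite !ffunE (negPf ne_ij).
by rewrite mnmBE mulmnE mnm1E eq_sym (negPf ne_ij) mul0n subn0.
Qed.

(** With the other coordinates fixed, [G] is a nonzero univariate polynomial of degree at most
    [degvar j G], so it has at most that many roots in [B]. *)
Lemma size_nonroots_update P (j : 'I_n) G (B : {fset K}) :
  (varcoef j (degvar j G) G).@[P] != 0 ->
  (#|` B| - degvar j G <= size [seq t <- B | G.@[update P j t] != 0%R])%N.
Proof.
set D := degvar j G => nz.
pose q := \poly_(e < D.+1) (varcoef j e G).@[P].
have q_eval t : q.[t] = G.@[update P j t].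
  by rewrite horner_poly (meval_update P t (leqnn _)).
have q_neq0 : q != 0.
  apply: contraNneq nz => /(congr1 (fun p : {poly K} => p`_D)).
  by rewrite coef_poly ltnSn coef0 => ->.
have lt_roots : (size [seq t <- B | G.@[update P j t] == 0%R] < size q)%N.
  apply: max_poly_roots => //; last by rewrite filter_uniq ?fset_uniq.
  by apply/allP => t; rewrite mem_filter => /andP[t0 _]; rewrite rootE q_eval.
have le_q : (size q <= D.+1)%N by apply: size_poly.
rewrite !size_filter in lt_roots *.
rewrite -(count_predC (fun t => G.@[update P j t] == 0) B).
by rewrite leq_subLR leq_add2r -ltnS (leq_trans lt_roots).
Qed.

(** * Counting nonzeros on a product of finite sets *)

Definition nonzeros (X : {fset {ffun 'I_n -> K}}) G : {fset {ffun 'I_n -> K}} :=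
  [fset P in X | G.@[P] != 0]%fset.

Lemma card_zeros_nonzeros (X : {fset {ffun 'I_n -> K}}) G :
  (#|` zeros X G| + #|` nonzeros X G| = #|` X|)%N.
Proof.
rewrite -[RHS](cardfsID (zeros X G)); congr (_ + _)%N; congr #|` _|.
  by apply/fsetP => P; rewrite !inE /=; case: (P \in X).
by apply/fsetP => P; rewrite !inE /=; case: (P \in X); rewrite ?andbT.
Qed.

Lemma card_cartesian (A : 'I_n -> {fset K}) :
  #|` cartesian A| = (\prod_i #|` A i|)%N.
Proof.
rewrite card_imfset; last first.
  move=> f g /ffunP eq_fg; apply/ffunP => i.
  by have := eq_fg i; rewrite !ffunE => /val_inj.
rewrite -cardE card_dep_ffun foldrE big_map big_enum.
by apply: eq_bigr => i _; rewrite cardfE.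
Qed.

(* The injection sends (P, t), with the top coefficient nonzero at P and G
   nonzero at P with t in position j, to that modified point and the old P j. *)
Lemma leq_card_nonzeros_varcoef (A : 'I_n -> {fset K}) (j : 'I_n) G :
  (#|` nonzeros (cartesian A) (varcoef j (degvar j G) G)| *
     (#|` A j| - degvar j G) <= #|` nonzeros (cartesian A) G| * #|` A j|)%N.
Proof.
set H := varcoef j _ G.
pose good P := [seq t <- A j | G.@[update P j t] != 0].
pose moves :=
  [seq (update P j t, P j) | P <- nonzeros (cartesian A) H, t <- good P].
pose target := [seq (Q, t) | Q <- nonzeros (cartesian A) G, t <- A j].
have le_moves :
    (#|` nonzeros (cartesian A) H| * (#|` A j| - degvar j G) <= size moves)%N.
  rewrite size_allpairs_dep sumnE big_map -sum1_size big_distrl /=.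
  rewrite big_seq [leqRHS]big_seq.
  apply: leq_sum => P; rewrite !inE mul1n => /andP[_ HP].
  exact: size_nonroots_update.
apply: (leq_trans le_moves); rewrite -(size_allpairs pair) -/target.
apply: uniq_leq_size.
  apply: allpairs_uniq_dep => [|P _|].
  - exact: fset_uniq.
  - by rewrite filter_uniq ?fset_uniq.
  move=> [P t] [Q u] _ _ /= [/ffunP eq_up eq_j].
  have eq_tu : t = u by have := eq_up j; rewrite !ffunE eqxx.
  have eq_PQ : P = Q.
    apply/ffunP => i; have [->//|ne_ij] := eqVneq i j.
    by have := eq_up i; rewrite !ffunE (negPf ne_ij).
  by rewrite eq_tu eq_PQ.
move=> _ /allpairsPdep[P [t [PH tP ->]]]; apply/allpairsPdep.
move: PH tP; rewrite !inE mem_filter in_cartesian.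
move=> /andP[/forallP PA _] /andP[Gt tA]; exists (update P j t), (P j).
split=> //; rewrite !inE Gt andbT in_cartesian; apply/forallP => i.
by rewrite ffunE; case: eqP => [->|].
Qed.

Lemma leq_degvar (i : 'I_n) G m : m \in msupp G -> (m i <= degvar i G)%N.
Proof. by move=> mG; rewrite /degvar (leq_bigmax_seq m). Qed.

Lemma degvar_witness (j : 'I_n) G :
  G != 0 -> exists2 m, m \in msupp G & m j = degvar j G.
Proof.
move=> G_neq0.
have [/hasP[m mG /eqP eq_m]|/hasPn ltG] :=
  boolP (has (fun m : 'X_{1..n} => m j == degvar j G) (msupp G)).
  by exists m.
have lt_m m : m \in msupp G -> (m j < degvar j G)%N.
  by move=> mG; rewrite ltn_neqAle ltG // leq_degvar.
have : (degvar j G <= (degvar j G).-1)%N.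
  by apply/bigmax_leqP_seq => m mG _; have := lt_m m mG; lia.
(* The inequality just proved is no contradiction in degree 0; the leading monomial forces the
   degree to be positive. *)
by have := lt_m _ (mlead_supp G_neq0); lia.
Qed.

Lemma const_degvar0 G : (forall i, degvar i G = 0%N) -> G = (G@_0%MM)%:MP.
Proof.
move=> deg0; apply/mpolyP => m; rewrite mcoeffC.
have [->|m_neq0] := eqVneq 0%MM m; first by rewrite mulr1.
rewrite mulr0; apply: memN_msupp_eq0; apply: contra m_neq0 => mG.
apply/eqP/mnmP => i; rewrite mnm0E; apply/eqP.
by rewrite eq_sym -leqn0 -(deg0 i) leq_degvar.
Qed.

Lemma varcoef_lead (j : 'I_n) G m :
  m \in msupp (varcoef j (degvar j G) G) ->
  m j = 0%N /\ (m + U_(j) *+ degvar j G)%MM \in msupp G.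
Proof.
rewrite msupp_varcoef => /mapP[m1]; rewrite mem_filter => /andP[/eqP <- m1G] ->.
by rewrite subm_varK mnmBE mulmnE mnm1E eqxx mul1n subnn.
Qed.

(** Induction on a list [s] containing every variable that occurs in [G]: the top coefficient in
    $t_j$ loses $t_j$, and the monomial found for it is multiplied back by $t_j^D$. *)
Lemma footprint_bound (A : 'I_n -> {fset K}) (s : seq 'I_n) G :
  (forall i, (degvar i G < #|` A i|)%N) ->
  (forall i, i \notin s -> degvar i G = 0%N) -> G != 0 ->
  exists2 m, m \in msupp G &
    (\prod_i (#|` A i| - m i) <= #|` nonzeros (cartesian A) G|)%N.
Proof.
elim: s G => [|j s IHs] G lt_deg deg0 G_neq0.
  (* With no variable left, [G] is a nonzero constant and every point is a nonzero. *)
  exists (mlead G); first exact: mlead_supp.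
  apply: (@leq_trans #|` cartesian A|).
    by rewrite card_cartesian; apply: leq_prod => i _; apply: leq_subr.
  apply/fsubset_leq_card/fsubsetP => P PA; rewrite !inE PA /=.
  have GC := const_degvar0 (fun i => deg0 i isT).
  by rewrite GC mevalC; apply: contra G_neq0 => /eqP c0; rewrite GC c0.
set D := degvar j G; pose H := varcoef j D G.
have le_H i : (degvar i H <= if i == j then 0 else degvar i G)%N.
  apply/bigmax_leqP_seq => m mH _; have [m_j mG] := varcoef_lead mH.
  have [->|ne_ij] := eqVneq i j; first by rewrite m_j.
  apply: leq_trans (leq_degvar i mG).
  by rewrite mnmDE leq_addr.
have H_neq0 : H != 0.
  have [m mG eq_m] := degvar_witness j G_neq0.
  rewrite -msupp_eq0; apply/eqP => suppH.
  have : (m - U_(j) *+ D)%MM \in msupp H.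
    rewrite msupp_varcoef; apply/mapP; exists m => //.
    by rewrite mem_filter eq_m eqxx.
  by rewrite suppH.
have [||m mH le_m] := IHs H _ _ H_neq0.
- move=> i; apply: leq_ltn_trans (le_H i) _.
  by case: eqP => // _; apply: leq_ltn_trans (lt_deg i).
- move=> i i_s; apply/eqP; rewrite -leqn0; apply: leq_trans (le_H i) _.
  by case: eqVneq => // ne_ij; rewrite deg0 // in_cons negb_or ne_ij.
have [m_j mG] := varcoef_lead mH; exists (m + U_(j) *+ D)%MM => //.
have A_gt0 : (0 < #|` A j|)%N by apply: leq_ltn_trans (lt_deg j).
rewrite -(leq_pmul2r A_gt0).
apply: leq_trans (leq_card_nonzeros_varcoef A j G).
apply: leq_trans (leq_mul le_m (leqnn _)).
rewrite (bigD1 j) //= [in leqRHS](bigD1 j) //= m_j subn0.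
rewrite mnmDE m_j mulmnE mnm1E eqxx mul1n add0n.
rewrite mulnC -mulnA leq_mul2l mulnC leq_mul2r.
apply/orP; right; apply/orP; right.
apply: leq_prod => i ne_ij; rewrite mnmDE mulmnE mnm1E eq_sym (negPf ne_ij).
by rewrite mul0n addn0.
Qed.

End VariableCoefficients.

Local Close Scope ring_scope.

(** * From the bound on nonzeros to the bound on zeros *)

Theorem proposition3p6 (K : fieldType) (n : nat) (hn : (1 <= n)%N)
    (A : 'I_n -> {fset K}) (hA : forall i, A i != fset0)
    (G : {mpoly K[n]}) (d : nat) (hd : (1 <= d)%N)
    (hG : msize G = d.+1)
    (hdeg : forall i, (degvar i G <= #|` A i| - 1)%N)
    (hmono : forall i j : 'I_n, j = i.+1 :> nat -> (#|` A i| <= #|` A j|)%N)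
    (* [k : 'I_n] encodes 0 <= k <= n - 1, and [A k] is the paper's A_{k+1} *)
    (k : 'I_n) (l : nat) (hl : (1 <= l <= #|` A k| - 1)%N)
    (hkl : d = (\sum_(i < n | i < k) (#|` A i| - 1) + l)%N) :
  (#|` zeros (cartesian A) G| <=
     (\prod_(i < n | k < i) #|` A i|) *
     ((\prod_(i < n | i <= k) #|` A i|) - #|` A k| + l))%N.
Proof.
have A_gt0 i : 0 < #|` A i| by rewrite cardfs_gt0.
have lt_deg i : degvar i G < #|` A i| by have := hdeg i; have := A_gt0 i; lia.
have G_neq0 : G != 0%R by rewrite -msize_poly_eq0 hG.
have [//|m mG le_m] := footprint_bound (s := enum 'I_n) lt_deg _ G_neq0.
  by move=> i; rewrite mem_enum.
have lt_m i : m i < #|` A i|.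
  by apply: leq_ltn_trans (lt_deg i); apply: leq_degvar.
(* [msize] is the total degree plus one, so [m] has degree at most [d]. *)
have le_mdeg : \sum_i m i <= \sum_(i < n | i < k) (#|` A i| - 1) + l.
  by rewrite -mdegE -hkl -ltnS -hG msize_mdeg_lt.
have lt_l : 0 < l < #|` A k| by have := A_gt0 k; lia.
have := prod_subn_geq (leq_mono_ord hmono) lt_m lt_l le_mdeg.
move/leq_trans/(_ le_m) => le_nz.
have := card_zeros_nonzeros (cartesian A) G; rewrite card_cartesian.
rewrite (bigID (fun i : 'I_n => i <= k)) /=.
rewrite (eq_bigl (fun i : 'I_n => k < i) _ (fun i => esym (ltnNge k i))).
(* This makes the truncated subtraction in the bound a true one. *)
have le_Ak : #|` A k| <= \prod_(i < n | i <= k) #|` A i|.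
  by rewrite (bigD1 k) //= leq_pmulr // prodn_cond_gt0.
rewrite -subnA //; last by case/andP: lt_l => _ /ltnW.
rewrite mulnBr [in X in _ -> _ <= X]mulnC [_ * (_ - l)]mulnC.
by move=> <-; rewrite -addnBA ?leq_addr.
Qed.
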